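(* There exists an admissible set $\Lambda\subset\mathbb{R}$ which is type 1 and which includes infinitely many algebraically independent numbers; that is, $\Lambda$ has an infinite subset consisting of algebraically independent numbers (in the sense defined in the context).
   Context: Convention: a set of (distinct) real numbers $\{\alpha_1,\alpha_2,\dots\}$ is said to consist of algebraically independent numbers if for each $N\in\mathbb{N}$, whenever $k_1,\dots,k_N\in\mathbb{Z}$ and $k_1\alpha_1+\dots+k_N\alpha_N=0$, then $k_1=\dots=k_N=0$ (that is, the numbers are linearly independent over $\mathbb{Q}$). A set $\Lambda\subset\mathbb{R}$ is called admissible if it is countably infinite, unbounded, bounded from below, and has no finite accumulation points. Let $\mu$ denote Lebesgue measure on $\mathbb{R}$. For an admissible $\Lambda$ and a (Lebesgue) measurable $f:\mathbb{R}\to[0,+\infty)$, put $s(x)=\sum_{\lambda\in\Lambda}f(x+\lambda)$, $C(f,\Lambda)=\{x\in\mathbb{R}: s(x)<\infty\}$ and $D(f,\Lambda)=\{x\in\mathbb{R}: s(x)=\infty\}$. The set $\Lambda$ is type 1 if for every measurable $f:\mathbb{R}\to[0,+\infty)$ either $\mu(D(f,\Lambda))=0$ or $\mu(C(f,\Lambda))=0$. Otherwise $\Lambda$ is type 2. *)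

(* Defs.v *)
From HB Require Import structures.
From mathcomp Require Import all_boot all_order all_algebra.
From mathcomp Require Import all_classical all_reals all_analysis.

Set Implicit Arguments.
Unset Strict Implicit.
Unset Printing Implicit Defensive.

Import Order.TTheory GRing.Theory Num.Theory.
Import numFieldNormedType.Exports.

Local Open Scope classical_set_scope.
Local Open Scope ring_scope.

(* A copy of R carrying the sigma-algebra of Lebesgue measurable sets (the
   domain of [completed_lebesgue_measure]); the default one on R is Borel. *)
Definition lebesgueTypeR (R : realType) :=
  caratheodory_type (@wlength R idfun)^*%mu.

Definition lebesgue_measurable_fun (R : realType) (f : R -> R) : Prop :=
  measurable_fun [set: lebesgueTypeR R] (f : lebesgueTypeR R -> R).

Definition admissible (R : realType) (L : set R) : Prop :=
  [/\ countable L, infinite_set L, ~ bounded_set L, has_lbound L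
    & limit_point L = set0].

Definition translate_sum (R : realType) (f : R -> R) (L : set R) (x : R) :
  \bar R := \esum_(l in L) (f (x + l))%:E.

Definition convergence_set (R : realType) (f : R -> R) (L : set R) : set R :=
  [set x | (translate_sum f L x < +oo)%E].

Definition divergence_set (R : realType) (f : R -> R) (L : set R) : set R :=
  [set x | translate_sum f L x = +oo%E].

Definition type1 (R : realType) (L : set R) : Prop :=
  forall f : R -> R, lebesgue_measurable_fun f -> (forall x, 0 <= f x) ->
    completed_lebesgue_measure (divergence_set f L) = 0%E \/
    completed_lebesgue_measure (convergence_set f L) = 0%E.

(* In the source terminology "algebraically independent" means linearly
   independent over the rationals, not independent as transcendentals. *)
Definition algebraically_independent (R : realType) (A : set R) : Prop :=
  forall (N : nat) (a : 'I_N -> R) (k : 'I_N -> int),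
    injective a -> (forall i, A (a i)) ->
    \sum_(i < N) (k i)%:~R * a i = 0 -> forall i, k i = 0.

(* Main.v *)
Require Import Defs.
From mathcomp Require Import all_boot all_order all_algebra.
From mathcomp Require Import all_classical all_reals all_analysis.
From mathcomp Require Import measurable_realfun.
From mathcomp Require Import ring lra zify.

Set Implicit Arguments.
Unset Strict Implicit.
Unset Printing Implicit Defensive.
Import Order.TTheory GRing.Theory Num.Theory.
Import numFieldNormedType.Exports.
Local Open Scope classical_set_scope.
Local Open Scope ring_scope.

(** Fix a transcendental [t] in ]0, 1/2[ and put, for [k >= 1], [g_k = 2^-i]
if [k = 2^i] and [g_k = t^i] if [2^i < k < 2^(i+1)].  Let [P_n] be the set of
all sums of an integer and of distinct elements among [g_1, ..., g_n], and let
[L] be the union of the sets [P_n] cut down to [[4n, 4n + 4[].  Each [P_n] is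
[Z] plus a finite set, so [L] is admissible.  It contains an integer translate
of every [t^i] with [i >= 1], and these numbers are linearly independent over
the rationals because [t] is transcendental ([independent_points]).

It remains to see why [L] is of type 1.  Let [s] be the sum of the translates
of [f], and [C] the set where [s] is finite; one may take [f] Borel, since a
null modification of [f] changes [s] on a null set only ([type1_of_borel]).

- [P_n] is stable under adding [2^-m] once [n >= 2^m], so [L + 2^-m] is
  contained in [L] up to a finite set, and [C + 2^-m] is contained in [C].

- [L - 1] is not contained in [L], but its new points lie in the intervals
  [[4k - 1, 4k[] and in [P_k], hence, up to one point, they are [z + g_k] for
  some [z] of [L] just below [4k].  The key estimate [backward_ae] shows that
  they contribute a finite amount at almost every point of [C].  So [C - 1] is
  contained in [C] up to a null set.

- Consequently [C] is invariant, up to null sets, under all dyadic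
  translations, and such a set is null or of full measure ([dyadic_zero_one]).

The key estimate is a maximal inequality.  Let [V_i] be the set of the [z]
above with [2^i <= k < 2^(i+1)], let [G_i] be the sum of [f (x + z)] over
[V_i], let [r_i] be the sum of the [G_l] with [l >= i], and let [d_i] be
[2^-i] or [t^i].  The claim is that the sum of the [G_i (x + d_i)] is finite
for almost all [x] in [C]; since every [V_i] is finite, each term may be capped
at 1.  Let [s x <= M].

If [r_(i+1) (x + d_i) <= 2M], then the capped term is the value at [x + d_i] of
[h_i], the restriction of [min (G_i, 1)] to the set where [r_(i+1) <= 2M].
The series of the [h_i] is bounded by [1 + 2M] everywhere, because from the
first [i] with [r_(i+1) <= 2M] on it is at most one capped term plus that
[r_(i+1)].  Integration is translation invariant, so the sum of the integrals
of the [h_i (x + d_i)] is finite as well.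

If [r_(i+1) (x + d_i) > 2M], consider the points [z] of the later windows.
Those with [z + d_i] in [L] contribute at most [s x <= M].  For the others all
of [z, z - d_i, ..., z - (2^i - 1) d_i] are in [L]: this is where the many
copies of [t^i] matter.  Hence [s (x + c d_i) > M] for [1 <= c <= 2^i], that
is, [x] does not come back to the set [s <= M] during [2^i] steps of length
[d_i].  The first [2^i] translates of the set of such [x] are disjoint, so
that, on a bounded interval, its measure is [O (2^-i)], which is summable. *)

(** * Translations and Lebesgue measure *)

Section shift.
Context {R : realType}.
Local Notation mu := (@lebesgue_measure R).

Lemma measurable_shift (c : R) :
  measurable_fun [set: R] (fun x : R => x + c).
Proof. by apply: measurable_funD. Qed.

Lemma measurable_preimage_shift (c : R) (A : set R) : measurable A ->
  measurable ((fun x : R => x + c) @^-1` A).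
Proof.
by move=> mA; rewrite -[X in measurable X]setTI; exact: measurable_shift.
Qed.

Lemma preimage_shift_itv (c a b : R) b1 b2 :
  (fun x : R => x + c) @^-1` [set` Interval (BSide b1 a) (BSide b2 b)] =
  [set` Interval (BSide b1 (a - c)) (BSide b2 (b - c))].
Proof.
apply/seteqP; split => x /=; rewrite !itv_boundlr /=; case: b1; case: b2;
  rewrite /Order.le/= ?lteBSide/= => /andP[h1 h2]; apply/andP; split; lra.
Qed.

Lemma lebesgue_measure_shift (c : R) (A : set R) : measurable A ->
  mu ((fun x : R => x + c) @^-1` A) = mu A.
Proof.
move=> mA; pose f : R -> measurableTypeR R := fun x => x + c.
have mf : measurable_fun [set: measurableTypeR R] f := measurable_shift c.
have <- : pushforward mu f A = mu ((fun x : R => x + c) @^-1` A) by [].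
apply/esym/lebesgue_measure_unique => // X [[a b] _ <-].
apply: (@etrans _ _ (mu `]a - c, b - c]%classic)); last first.
  by rewrite -preimage_shift_itv.
rewrite !lebesgue_measure_itv/= !lte_fin.
rewrite ltrD2r; case: ifP => // _; congr (_%:E); ring.
Qed.

Lemma ge0_integral_shift (c : R) (h : R -> \bar R) :
  measurable_fun [set: R] h -> (forall x, (0 <= h x)%E) ->
  (\int[mu]_x h (x + c)%R = \int[mu]_x h x)%E.
Proof.
move=> mh h0; pose f : R -> measurableTypeR R := fun x => x + c.
have mf : measurable_fun [set: measurableTypeR R] f := measurable_shift c.
transitivity (\int[pushforward mu f]_x h x)%E.
  by rewrite ge0_integral_pushforward//= preimage_setT.
by apply: eq_measure_integral => A mA _; exact: lebesgue_measure_shift.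
Qed.

End shift.

(** * Zero-one law for dyadic translations *)

Section ergodic.
Context {R : realType}.
Local Notation mu := (@lebesgue_measure R).
Variable C : set R.
Hypotheses (mC : measurable C)
  (C_fwd : forall m x, C x -> C (x + (2 ^+ m)^-1))
  (C_bwd : mu (C `\` [set x | C (x - 1)]) = 0%E).

Let nu (A : set R) := mu (C `&` A).
Let T (c : R) (A : set R) := (fun x : R => x + c) @^-1` A.

Let mT c A : measurable A -> measurable (T c A).
Proof. exact: measurable_preimage_shift. Qed.

Let nu_le A B : measurable A -> measurable B -> A `<=` B -> (nu A <= nu B)%E.
Proof.
move=> mA mB AB; apply: le_measure; rewrite ?inE; try exact: measurableI.
exact: setIS.
Qed.

Let TD c d A : T c (T d A) = T (d + c) A.
Proof. by apply/seteqP; split => x; rewrite /T/= addrAC addrA. Qed.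

Let T0 A : T 0 A = A.
Proof. by apply/seteqP; split => x; rewrite /T/= addr0. Qed.

Let nu_fwd m A : measurable A -> (nu A <= nu (T (- (2 ^+ m)^-1) A))%E.
Proof.
move=> mA; have mCA : measurable (C `&` A) by exact: measurableI.
rewrite /nu -(lebesgue_measure_shift (- (2 ^+ m)^-1) mCA).
apply: le_measure; rewrite ?inE; first exact: mT.
  by apply: measurableI => //; exact: mT.
move=> x [/= Cx Ax]; split => //.
by have := C_fwd m Cx; rewrite subrK.
Qed.

Let nu_bwd A : measurable A -> (nu A <= nu (T 1 A))%E.
Proof.
move=> mA.
have mCm : measurable [set x | C (x - 1)] by exact: (mT (-1) mC).
have mCA : measurable (C `&` T 1 A) by apply: measurableI => //; exact: mT.
rewrite /nu -(lebesgue_measure_shift (- 1) mCA).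
pose D := (C `\` [set x | C (x - 1)]); pose E := T (-1) (C `&` T 1 A).
have mE : measurable E by exact: mT.
have mD : measurable D by exact: measurableD.
apply: (@le_trans _ _ (mu (E `|` D))).
  apply: le_measure; rewrite ?inE; first exact: measurableI.
    exact: measurableU.
  move=> x [Cx Ax]; have [Cx1|nCx1] := pselect (C (x - 1)).
    by left; rewrite /E /T/= subrK.
  by right.
apply: (le_trans (measureU2
  (mu : {measure set (measurableTypeR R) -> \bar R}) mE mD)).
by rewrite /D /= C_bwd adde0.
Qed.

Let nu_fwdn m n A : measurable A ->
  (nu A <= nu (T (- (n%:R * (2 ^+ m)^-1)) A))%E.
Proof.
move=> mA; elim: n => [|n IH].
  by rewrite mul0r oppr0 T0.
apply: (le_trans IH); apply: (le_trans (nu_fwd m (mT _ mA))).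
by rewrite TD -[n.+1%:R]natr1 mulrDl mul1r opprD.
Qed.

(** The chain [A], [A + 2^-m], ..., [A + 1] has nondecreasing [nu], and the
backward hypothesis closes it into a cycle. *)
Let nu_invar m A : measurable A -> nu (T (- (2 ^+ m)^-1) A) = nu A.
Proof.
move=> mA; apply/eqP; rewrite eq_le nu_fwd// andbT.
have m2 : (2 ^+ m : R) != 0 by rewrite expf_neq0.
apply: (le_trans (nu_fwdn m (2 ^ m).-1 (mT _ mA))).
apply: (le_trans (nu_bwd (mT _ (mT _ mA)))); rewrite !TD.
have e : (2 ^ m).-1%:R = 2 ^+ m - 1 :> R.
  by rewrite -subn1 natrB ?expn_gt0// natrX.
rewrite (_ : - (2 ^+ m)^-1 + _ = 0 :> R); last by rewrite e; field.
by rewrite T0.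
Qed.

Let nu_invarn m n A : measurable A -> nu (T (- (n%:R * (2 ^+ m)^-1)) A) = nu A.
Proof.
move=> mA; elim: n => [|n IH].
  by rewrite mul0r oppr0 T0.
rewrite -[n.+1%:R]natr1 mulrDl mul1r opprD addrC -TD.
rewrite [LHS](_ : _ = nu (T (- (2 ^+ m)^-1) (T (- (n%:R / 2 ^+ m)) A))).
  by rewrite nu_invar//; exact: mT.
by rewrite !TD addrC.
Qed.

Let I (a b : R) : set R := `]a, b]%classic.

Let nuI_shift m n a b : nu (I (a + n%:R * (2 ^+ m)^-1) (b + n%:R * (2 ^+ m)^-1))
  = nu (I a b).
Proof.
rewrite -(nu_invarn m n (measurable_itv `]a, b])).
by rewrite /T preimage_shift_itv !opprK.
Qed.

Let nuI_shiftz m (k : int) a b :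
  nu (I (a + k%:~R * (2 ^+ m)^-1) (b + k%:~R * (2 ^+ m)^-1)) = nu (I a b).
Proof.
case: k => n; first exact: nuI_shift.
by rewrite NegzE -(nuI_shift m n.+1) !mulrNz !mulNr !subrK.
Qed.

Let nuI_cat a b c : a <= b -> b <= c ->
  nu (I a c) = (nu (I a b) + nu (I b c))%E.
Proof.
move=> ab bc; rewrite /nu.
have -> : I a c = I a b `|` I b c.
  apply/seteqP; split => x; rewrite /I/= !in_itv/=.
    move=> /andP[ax xc]; case: (leP x b) => xb; [left|right].
      by rewrite ax.
    by rewrite xc.
  move=> [|] /andP[h1 h2]; apply/andP; split; lra.
rewrite setIUr measureU//;
  try by apply: measurableI => //; exact: measurable_itv.
apply/seteqP; split => // x [[_ +] [_]].
by rewrite /I/= !in_itv/= => /andP[_ h1] /andP[h2 _]; lra.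
Qed.

Let nu_fin a b : nu (I a b) \is a fin_num.
Proof.
rewrite ge0_fin_numE//.
apply: (@le_lt_trans _ _ (mu (I a b))).
  apply: le_measure; rewrite ?inE//; try exact: measurable_itv.
  by apply: measurableI => //; exact: measurable_itv.
rewrite /I lebesgue_measure_itv/=; case: ifP => // _.
by rewrite -EFinB ltry.
Qed.

Let p := fine (nu (I 0 1)).

Let nuI_n m n : nu (I 0 (n%:R * (2 ^+ m)^-1)) =
  (n%:R * fine (nu (I 0 (2 ^+ m)^-1)))%:E.
Proof.
have m2 : 0 < (2 ^+ m : R)^-1 by rewrite invr_gt0 exprn_gt0.
elim: n => [|n IH].
  by rewrite !mul0r /nu /I set_itvoc0 setI0 measure0.
rewrite (@nuI_cat _ (n%:R / 2 ^+ m)); last 2 first.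
- by rewrite mulr_ge0// ltW.
- by rewrite ler_pM2r// ler_nat.
rewrite IH -[n.+1%:R]natr1 [n%:R + 1]addrC !mulrDl !mul1r EFinD addeC.
congr (_ + _)%E.
have := nuI_shift m n 0 (2 ^+ m)^-1; rewrite add0r => ->.
by rewrite fineK.
Qed.

Let nuI_unit m : fine (nu (I 0 (2 ^+ m)^-1)) = p / 2 ^+ m.
Proof.
have m2 : (2 ^+ m : R) != 0 by rewrite expf_neq0.
have := nuI_n m (2 ^ m); rewrite natrX divff// => h.
by rewrite /p h/= mulrC mulKf.
Qed.

Let nuI_dyadic m (k : int) n :
  nu (I (k%:~R / 2 ^+ m) ((k + Posz n)%:~R / 2 ^+ m)) = (n%:R / 2 ^+ m * p)%:E.
Proof.
rewrite intrD addrC mulrDl -[X in I X _]add0r nuI_shiftz nuI_n nuI_unit.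
by congr (_%:E); ring.
Qed.

Let nuI_le a b c d : c <= a -> b <= d ->
  fine (nu (I a b)) <= fine (nu (I c d)).
Proof.
move=> ca bd; apply: fine_le => //; apply: nu_le; try exact: measurable_itv.
by move=> x; rewrite /I/= !in_itv/= => /andP[h1 h2]; apply/andP; split; lra.
Qed.

Let p_ge0 : 0 <= p.
Proof. by rewrite fine_ge0. Qed.

(** Approximation of [I a b] from inside and outside by unions of cells of the
grid of step [2^-m]. *)
Let nuI_close m a b : a < b ->
  `|fine (nu (I a b)) - p * (b - a)| <= 2 / 2 ^+ m * p.
Proof.
move=> ab; set e := (2 ^+ m : R)^-1.
have e0 : 0 < e by rewrite invr_gt0 exprn_gt0.
pose k := Num.floor (a / e); pose l := Num.floor (b / e).
have /andP[k1 k2] := floor_itv (a / e); have /andP[l1 l2] := floor_itv (b / e).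
rewrite -/k ler_pdivlMr// in k1; rewrite -/k ltr_pdivrMr// intrD in k2.
rewrite -/l ler_pdivlMr// in l1; rewrite -/l ltr_pdivrMr// intrD in l2.
have kl : k <= l by apply: le_floor; rewrite ler_pM2r ?invr_gt0// ltW.
have dy (i : int) n : fine (nu (I (i%:~R * e) ((i + Posz n)%:~R * e)))
   = n%:R * e * p by rewrite nuI_dyadic.
rewrite ler_norml; apply/andP; split; last first.
  have [n En] : exists n, l + 1 = k + Posz n.
    by exists (absz (l + 1 - k)%R); lia.
  have h := dy k n; rewrite -En in h.
  have : fine (nu (I a b)) <= n%:R * e * p.
    by rewrite -h; apply: nuI_le; [exact: k1|rewrite intrD ltW].
  have : n%:R = l%:~R + 1 - k%:~R :> R.
    rewrite -[n%:R]/((Posz n)%:~R) -[1]/(1%:~R) -intrD -intrB En.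
    by congr (_%:~R); lia.
  move=> -> hh; have : ((l%:~R + 1 - k%:~R) * e) * p <= (b - a + 2 * e) * p.
    by rewrite ler_wpM2r//; lra.
  by lra.
have [kl1|kl1] := eqVneq k l.
  have kR : k%:~R = l%:~R :> R by rewrite kl1.
  have : (b - a) * p <= e * p.
    by rewrite ler_wpM2r//; rewrite kR in k1; lra.
  have : 0 <= fine (nu (I a b)) by rewrite fine_ge0.
  have : 0 <= e * p by rewrite mulr_ge0// ltW.
  lra.
have [n En] : exists n, l = k + 1 + Posz n.
  by exists (absz (l - k - 1)%R); move: kl kl1; lia.
have h := dy (k + 1) n; rewrite -En in h.
have : n%:R * e * p <= fine (nu (I a b)).
  by rewrite -h; apply: nuI_le; [rewrite intrD ltW|exact: l1].
have : n%:R = l%:~R - 1 - k%:~R :> R.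
  by rewrite -[n%:R]/((Posz n)%:~R) -[1]/(1%:~R) -!intrB; congr (_%:~R); lia.
move=> -> hh; have : (b - a - 2 * e) * p <= ((l%:~R - 1 - k%:~R) * e) * p.
  by rewrite ler_wpM2r//; lra.
by lra.
Qed.

Let nuI a b : a < b -> fine (nu (I a b)) = p * (b - a).
Proof.
move=> ab; apply/eqP; rewrite -subr_eq0 -normr_le0.
apply/ler_addgt0Pr => e e0; rewrite add0r.
have p1 : 0 < p + 1 by have := p_ge0; lra.
have ep : 0 < e / 2 / (p + 1) by rewrite !divr_gt0.
near \oo => m.
apply: (le_trans (nuI_close m ab)).
have : 1 / 2 ^+ m < (PosNum ep)%:num :> R.
  by near: m; exact: near_infty_natSinv_expn_lt.
rewrite /= => h.
have : 2 * (1 / 2 ^+ m) * p <= 2 * (e / 2 / (p + 1)) * p.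
  by rewrite ler_wpM2r// ler_pM2l// ltW.
have : 2 * (e / 2 / (p + 1)) * p <= e.
  rewrite (_ : 2 * _ * p = e * (p / (p + 1))); last by field; rewrite gt_eqF.
  by rewrite ger_pMr// ler_pdivrMr// mul1r lerDl.
rewrite mul1r; lra.
Unshelve. all: by end_near. Qed.

(** The measure [A |-> mu (C /\ A)] is invariant under dyadic translations, so
it is [p * mu] for some [p].  If [p] is not 0, evaluating at the complement
of [C] gives [p * mu (~` C) = 0]. *)
Lemma dyadic_zero_one : mu C = 0%E \/ mu (~` C) = 0%E.
Proof.
have nuIE a b : a < b -> nu (I a b) = (p * (b - a))%:E.
  by move=> ab; rewrite -(nuI ab) fineK.
have [p0|p_neq0] := eqVneq p 0.
  left; pose J n : set R := `]- n%:R, n%:R]%classic.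
  have : (mu (\bigcup_n (C `&` J n)) <= \sum_(0 <= n <oo) mu (C `&` J n))%E.
    apply: measure_sigma_subadditive => //.
      by move=> n; apply: measurableI => //; exact: measurable_itv.
    apply: bigcupT_measurable => n.
    by apply: measurableI => //; exact: measurable_itv.
  rewrite -setI_bigcupr /J bigcup_itvT setIT eseries0; last first.
    move=> [|n] _ _; first by rewrite /J oppr0 set_itvoc0 setI0 measure0.
    by rewrite /J -/(I _ _) -/(nu _) nuIE ?p0 ?mul0r// gtrN.
  by move=> h; apply/eqP; rewrite eq_le h measure_ge0.
right; have p_gt0 : 0 < p by rewrite lt_neqAle eq_sym p_neq0 p_ge0.
have ip : 0 <= p^-1 by rewrite invr_ge0.
pose mu' : {measure set (measurableTypeR R) -> \bar R} :=
  mscale (NngNum ip)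
    (mrestr (mu : {measure set (measurableTypeR R) -> \bar R}) mC).
have mu'E B : mu' B = ((p^-1)%:E * nu B)%E by rewrite /nu setIC.
have muE A : measurable A -> mu A = mu' A.
  apply: lebesgue_measure_unique => X [[a b] _ <-].
  rewrite mu'E.
  have [ab|ba] := ltP a b; last first.
    by rewrite set_itv_ge ?bnd_simp -?leNgt// /nu setI0 !measure0 mule0.
  rewrite -/(I a b) nuIE// lebesgue_measure_itv/= lte_fin ab.
  by rewrite -EFinM mulKf// EFinB.
rewrite (muE _ (measurableC mC)) mu'E /nu setICr.
by rewrite measure0 mule0.
Qed.

End ergodic.

(** * Sums of translates over subsets *)

Section translate_sum_theory.
Context {R : realType}.
Variable f : R -> R.
Hypothesis f0 : forall x, 0 <= f x.
Implicit Types (V W : set R) (x : R).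

Lemma translate_sum_ge0 V x : (0 <= translate_sum f V x)%E.
Proof. by apply: esum_ge0 => l _; rewrite lee_fin. Qed.

Lemma translate_sum_subset V W x : V `<=` W ->
  (translate_sum f V x <= translate_sum f W x)%E.
Proof.
move=> VW; apply: le_ereal_sup => _ [A [finA AV] <-]; exists A => //.
by split => //; exact: subset_trans VW.
Qed.

Lemma translate_sum_image c V x :
  translate_sum f ((fun z => z + c) @` V) x = translate_sum f V (x + c).
Proof.
rewrite /translate_sum esum_image; last by move=> y z _ _ /addIr.
by apply: eq_esum => l _; rewrite addrA addrAC.
Qed.

Lemma translate_sumID W V x : translate_sum f V x =
  (translate_sum f (V `&` W) x + translate_sum f (V `&` ~` W) x)%E.
Proof. by rewrite /translate_sum (esumID W)// => l _; rewrite lee_fin. Qed.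

Lemma translate_sumU V W x :
  (translate_sum f (V `|` W) x <= translate_sum f V x + translate_sum f W x)%E.
Proof.
rewrite (translate_sumID V) leeD//; apply: translate_sum_subset => y.
  by case.
by case=> -[].
Qed.

Lemma translate_sum_bigcup (F : nat -> set R) x : trivIset setT F ->
  translate_sum f (\bigcup_n F n) x = (\sum_(n <oo) translate_sum f (F n) x)%E.
Proof.
move=> tF; rewrite /translate_sum nneseries_sum_bigcup// => l.
by rewrite lee_fin.
Qed.

Lemma translate_sum_bigcup_le (F : nat -> set R) x :
  (translate_sum f (\bigcup_n F n) x <= \sum_(n <oo) translate_sum f (F n) x)%E.
Proof.
rewrite seqDU_bigcup_eq translate_sum_bigcup; last exact: trivIset_seqDU.
apply: lee_nneseries => n _; first by move=> *; exact: translate_sum_ge0.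
by apply: translate_sum_subset; exact: subset_seqDU.
Qed.

Lemma translate_sum_finite V x : finite_set V -> (translate_sum f V x < +oo)%E.
Proof.
move=> finV; rewrite /translate_sum esum_fset//; last first.
  by move=> l _; rewrite lee_fin.
by rewrite fsumEFin// ltry.
Qed.

Lemma measurable_translate_sum V : measurable_fun [set: R] f -> countable V ->
  measurable_fun [set: R] (translate_sum f V).
Proof.
move=> mf /countable_injP[e einj].
pose g := 'pinv_(fun=> 0) V e.
have gK a : V a -> g (e a) = a by move=> Va; rewrite /g pinvKV ?inE.
have Vimg : V = [set g n | n in e @` V].
  apply/seteqP; split => [a Va|_ [_ [a Va <-] <-]]; last by rewrite gK.
  by exists (e a); [exists a|exact: gK].
rewrite (_ : translate_sum f V =
    fun x => \sum_(n <oo | n \in e @` V) (f (x + g n)%R)%:E)%E; last first.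
  apply/funext => x; rewrite /translate_sum [in LHS]Vimg esum_set_image//.
  by move=> n _; rewrite lee_fin.
apply: (@ge0_emeasurable_sum _ _ _ _ (fun n x => (f (x + g n))%:E)
  (fun n => n \in e @` V)) => [n x _ _|n _]; first by rewrite lee_fin.
apply/measurable_EFinP.
by apply: (measurableT_comp mf); exact: measurable_shift.
Qed.

End translate_sum_theory.

(** The capped terms tend to 0, so the cap is inactive from some rank on. *)
Lemma nneseries_mine1_lty {R : realType} (u : nat -> \bar R) :
  (forall i, (0 <= u i)%E) -> (forall i, (u i < +oo)%E) ->
  (\sum_(i <oo) mine (u i) 1 < +oo)%E -> (\sum_(i <oo) u i < +oo)%E.
Proof.
move=> u0 uoo sumoo.
have m0 i : (0 <= mine (u i) 1)%E by rewrite le_min u0 lee01.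
have tail := @nneseries_tail_cvg R _ xpredT sumoo (fun i _ => m0 i).
have /fine_cvgP[finT cvgT] := tail.
near \oo => n.
have small : (\sum_(n <= i <oo) mine (u i) 1 < 1)%E.
  have finn : (\sum_(n <= i <oo) mine (u i) 1)%E \is a fin_num by near: n.
  rewrite -(fineK finn) lte_fin; near: n.
  exact: (cvgr_lt _ cvgT _ ltr01).
have E i : (n <= i)%N -> u i = mine (u i) 1%E.
  move=> ni; have : (mine (u i) 1 < 1)%E.
    apply: le_lt_trans small.
    rewrite (@nneseries_split _ _ n (i - n).+1)//.
    rewrite addnS big_nat_recr/= ?leq_addr// subnKC// -addeA addeCA.
    by apply: leeDl; rewrite adde_ge0 ?sume_ge0// nneseries_ge0.
  by rewrite minElt; case: ifP => //; rewrite ltxx.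
rewrite (@nneseries_split _ _ 0 n)// add0n; apply: lte_add_pinfty.
  by apply: lte_sum_pinfty.
have -> : (\sum_(n <= k <oo) u k = \sum_(n <= k <oo) mine (u k) 1)%E.
  by apply/congr_lim/funext => m; apply: eq_big_nat => i /andP[/E].
apply: le_lt_trans sumoo; rewrite [leRHS](@nneseries_split _ _ 0 n)// add0n.
by apply: leeDr; rewrite sume_ge0.
Unshelve. all: by end_near. Qed.

(** * The maximal inequality *)

Section backward.
Context {R : realType}.
Local Notation mu :=
  (@lebesgue_measure R : {measure set (measurableTypeR R) -> \bar R}).
Variables (L : set R) (V : nat -> set R) (d : nat -> R) (f : R -> R).
Hypotheses (cL : countable L) (VL : forall i, V i `<=` L)
  (tV : trivIset [set: nat] V) (finV : forall i, finite_set (V i))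
  (d0 : forall i, 0 <= d i) (d1 : forall i, d i * 2 ^+ i <= 1)
  (LV : forall i l z, (i < l)%N -> V l z ->
    L (z + d i) \/ forall c, (c < 2 ^ i)%N -> L (z - c%:R * d i))
  (mf : measurable_fun [set: R] f) (f0 : forall x, 0 <= f x).

Let s x := translate_sum f L x.
Let G i x := translate_sum f (V i) x.
Let W i : set R := \bigcup_(l in [set l | (i <= l)%N]) V l.
Let r i x := translate_sum f (W i) x.

Let WL i : W i `<=` L. Proof. by move=> z [l _ /VL]. Qed.

Let countS A : A `<=` L -> countable A.
Proof. by move=> AL; exact: sub_countable (subset_card_le AL) cL. Qed.

Let ms : measurable_fun [set: R] s.
Proof. exact: measurable_translate_sum. Qed.

Let mG i : measurable_fun [set: R] (G i).
Proof. by apply: measurable_translate_sum => //; exact/countS/VL. Qed.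

Let mr i : measurable_fun [set: R] (r i).
Proof. by apply: measurable_translate_sum => //; exact/countS/WL. Qed.

Let s_ge0 x : (0 <= s x)%E. Proof. exact: translate_sum_ge0. Qed.
Let G_ge0 i x : (0 <= G i x)%E. Proof. exact: translate_sum_ge0. Qed.

Let rE i x : r i x = (\sum_(l <oo | (i <= l)%N) G l x)%E.
Proof.
rewrite /r /translate_sum esum_bigcupT//; last first.
  by move=> z; rewrite lee_fin.
rewrite nneseries_esum//.
Qed.

(** A point [z] of a later window with [z + d i] outside [L] yields the point
[z - (c - 1) * d i] of [L], and [x + d i + z] is also
[x + c * d i + (z - (c - 1) * d i)]. *)
Let r_escape M i x : (s x <= M%:E)%E -> ((2 * M)%:E < r i.+1 (x + d i)%R)%E ->
  forall c, (0 < c <= 2 ^ i)%N -> (M%:E < s (x + c%:R * d i)%R)%E.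
Proof.
move=> sM rM c /andP[c0 c2]; pose P : set R := [set z | L (z + d i)].
rewrite /r (translate_sumID f0 P) in rM.
have h1 : (translate_sum f (W i.+1 `&` P) (x + d i)%R <= s x)%E.
  rewrite -translate_sum_image; apply: translate_sum_subset => //.
  by move=> _ [z [_ /= ?] <-].
have h2 : (translate_sum f (W i.+1 `&` ~` P) (x + d i)%R
    <= s (x + c%:R * d i)%R)%E.
  have -> : x + d i = (x + c%:R * d i) + - (c.-1%:R * d i).
    by rewrite -{1}(prednK c0) -[c.-1.+1%:R]natr1; ring.
  rewrite -translate_sum_image; apply: translate_sum_subset => //.
  move=> _ [z [[l il Vz] /= nL] <-].
  have [//|] := LV il Vz; apply; by rewrite prednK.
have : ((2 * M)%:E < M%:E + s (x + c%:R * d i)%R)%E.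
  apply: (lt_le_trans rM); rewrite leeD//; exact: le_trans sM.
by rewrite mulr2n mulrDl !mul1r EFinD lteD2lE.
Qed.

Section window.
Variables (M N : R).
Hypotheses (M0 : 0 <= M) (N0 : 0 <= N).

Let J : set R := `[- N, N]%classic.
Let J' : set R := `[- N, N + 1]%classic.
(** The points where the tail after stage [i] is large at [x + d i]; they do not
return to [s <= M] for [2 ^ i] steps. *)
Let A i : set R :=
  [set x | J x /\ ((s x <= M%:E)%E /\ ((2 * M)%:E < r i.+1 (x + d i)%R)%E)].

Let mshift (h : R -> \bar R) c : measurable_fun [set: R] h ->
  measurable_fun [set: R] (fun x => h (x + c)).
Proof. by move=> mh; apply: (measurableT_comp mh); exact: measurable_shift. Qed.

Let mle (h : R -> \bar R) (y : \bar R) : measurable_fun [set: R] h ->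
  measurable [set x | (h x <= y)%E].
Proof.
move=> mh; rewrite -[X in measurable X]setTI.
exact: emeasurable_fun_infty_c.
Qed.

Let mA i : measurable (A i).
Proof.
apply: measurableI; first exact: measurable_itv.
apply: measurableI; first exact: mle.
rewrite -[X in measurable X]setTI; apply: emeasurable_fun_o_infty => //.
exact: (mshift (d i) (mr i.+1)).
Qed.

Let A_shift_disjoint i : trivIset `I_(2 ^ i)
  (fun c => (fun x => x + - (c%:R * d i)) @^-1` A i).
Proof.
have main c c' y : (c < c')%N -> (c' < 2 ^ i)%N ->
    A i (y - c%:R * d i) -> A i (y - c'%:R * d i) -> False.
  move=> cc' c'i [_ [sM _]] [_ [sM' rM]].
  have := @r_escape M i _ sM' rM (c' - c)%N.
  have -> : y - c'%:R * d i + (c' - c)%:R * d i = y - c%:R * d i.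
    by rewrite natrB ?(ltnW cc')//; ring.
  rewrite ltNge sM => /(_ _)/negP; apply => //.
  by rewrite subn_gt0 cc' (leq_trans (leq_subr _ _))// ltnW.
move=> c c' /= ci c'i [y [/= Ay Ay']].
case: (ltngtP c c') => // cc'; exfalso.
  exact: (main c c' y).
exact: (main c' c y).
Qed.

Let muJ' : lebesgue_measure J' = (2 * N + 1)%:E.
Proof.
have h : - N < N + 1 by move: N0 => ?; lra.
rewrite /J' lebesgue_measure_itv/= lte_fin h.
by rewrite -EFinB; congr (_%:E); ring.
Qed.

(** [2 ^ i] disjoint translates of [A i] fit in [J']. *)
Let muA i : (mu (A i) <= ((2 * N + 1) / 2 ^+ i)%:E)%E.
Proof.
pose F c : set R := (fun x => x + - (c%:R * d i)) @^-1` A i.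
have mF c : measurable (F c) by apply: measurable_preimage_shift; exact: mA.
have FJ c : (c < 2 ^ i)%N -> F c `<=` J'.
  move=> ci y [+ _]; rewrite /J /J' /= !in_itv/= => /andP[h1 h2].
  have cd0 : 0 <= c%:R * d i by rewrite mulr_ge0.
  have cd1 : c%:R * d i <= 1.
    apply: le_trans (d1 i); rewrite mulrC ler_wpM2l//.
    by rewrite -natrX ler_nat ltnW.
  by apply/andP; split; lra.
have : (\sum_(c < 2 ^ i) mu (F c) <= (2 * N + 1)%:E)%E.
  rewrite -(@measure_semi_additive_ord_I _ _ _ mu F); last 3 first.
  - by move=> c _; exact: mF.
  - exact: A_shift_disjoint.
  - by apply: bigsetU_measurable => c _; exact: mF.
  rewrite -muJ'.
  apply: le_measure; rewrite ?inE; [|exact: measurable_itv|].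
    by apply: bigsetU_measurable => c _; exact: mF.
  by rewrite -bigcup_mkord => y [c /= ci]; exact: FJ.
rewrite (eq_bigr (fun=> lebesgue_measure (A i))); last first.
  by move=> c _; exact: lebesgue_measure_shift.
have -> n : (\sum_(c < n) lebesgue_measure (A i) =
    n%:R%:E * lebesgue_measure (A i))%E.
  elim: n => [|n IH]; first by rewrite big_ord0 mul0e.
  rewrite big_ord_recr/= IH -[n.+1%:R]natr1 EFinD.
  by rewrite ge0_muleDl ?lee_fin// mul1e.
rewrite natrX => h.
have p2 : (0 < 2 ^+ i :> R) by rewrite exprn_gt0.
by rewrite mulrC EFinM lee_pdivlMl.
Qed.

Let g i (y : R) : \bar R := mine (G i y) 1%E.
Let Q i : set R := [set y | (r i.+1 y <= (2 * M)%:E)%E] `&` J'.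
Let h i : R -> \bar R := g i \_ (Q i).
Let K : set R := J `&` [set x | (s x <= M%:E)%E].
Let Phi i : R -> \bar R := (fun x => g i (x + d i)) \_ K.

Let g_ge0 i y : (0 <= g i y)%E.
Proof. by rewrite /g le_min G_ge0 lee01. Qed.

Let mg i : measurable_fun [set: R] (g i).
Proof. by apply: measurable_mine. Qed.

Let h_ge0 i y : (0 <= h i y)%E.
Proof. by apply: erestrict_ge0 => z _. Qed.

Let Phi_ge0 i y : (0 <= Phi i y)%E.
Proof. by apply: erestrict_ge0 => z _. Qed.

Let mh i : measurable_fun [set: R] (h i).
Proof.
have mQ : measurable (Q i).
  by apply: measurableI; [exact: mle|exact: measurable_itv].
by apply/(measurable_restrictT _ mQ); exact: measurable_funTS.
Qed.

Let mPhi i : measurable_fun [set: R] (Phi i).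
Proof.
have mK : measurable K.
  by apply: measurableI; [exact: measurable_itv|exact: mle].
by apply/(measurable_restrictT _ mK)/measurable_funTS; exact: mshift.
Qed.

(** If [n] is the least index with [r n.+1 y <= 2 * M], then [h i y = 0] for
[i < n], [h n y <= 1], and the remaining terms add up to at most [r n.+1 y]. *)
Let h_sum y :
  (\sum_(i <oo) h i y <= (cst (1 + 2 * M)%:E \_ J') y)%E.
Proof.
have [yJ|yJ] := boolP (y \in J'); last first.
  rewrite eseries0; first by rewrite patchE (negbTE yJ).
  move=> i _ _; rewrite /h patchE ifN//.
  by apply: contra yJ; rewrite !inE => -[].
rewrite [leRHS]patchE yJ.
have [[i ri]|nr] := pselect (exists i, (r i.+1 y <= (2 * M)%:E)%E); last first.
  rewrite eseries0 ?lee_fin; first by rewrite addr_ge0// mulr_ge0.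
  move=> i _ _; rewrite /h patchE ifN//; apply/negP.
  by rewrite inE => -[/= ri _]; apply: nr; exists i.
have := @ex_minnP (fun i => (r i.+1 y <= (2 * M)%:E)%E) (ex_intro _ i ri).
case=> n rn nmin.
rewrite (nneseriesD1 (n := n))// EFinD leeD//.
  rewrite /h patchE; case: ifPn => _ //.
  by rewrite /g ge_min lexx orbT.
apply: le_trans rn; rewrite rE eseries_mkcond [leRHS]eseries_mkcond.
apply: lee_nneseries => k _; first by case: ifP.
rewrite /h patchE; case: ifPn => [kn|_]; last by case: ifP.
case: ifPn => [|_]; last by case: ifP.
rewrite inE => -[/= rk _]; rewrite ltn_neqAle eq_sym (nmin _ rk).
rewrite (kn : k != n)/=.
by rewrite /g ge_min lexx.
Qed.

Let Phi_le i x : (Phi i x <= (\1_(A i) x)%:E + h i (x + d i)%R)%E.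
Proof.
rewrite /Phi patchE; case: ifPn => [|_]; last by rewrite adde_ge0 ?lee_fin.
rewrite inE => -[Jx sM].
have J'x : J' (x + d i).
  move: Jx; rewrite /J /J' /= !in_itv/= => /andP[h1 h2].
  have di0 := d0 i; have di1 : d i <= 1.
    by apply: le_trans (d1 i); rewrite ler_peMr// exprn_ege1// ler1n.
  by apply/andP; split; lra.
have [rM|rM] := leP (r i.+1 (x + d i)) (2 * M)%:E.
  rewrite /h patchE mem_set; last by split.
  by rewrite leeDr ?lee_fin.
rewrite indicE mem_set; last by [].
apply: (@le_trans _ _ 1%E); first by rewrite /g ge_min lexx orbT.
by rewrite leeDl.
Qed.

Let sum_muA : (\sum_(i <oo) mu (A i) < +oo)%E.
Proof.
apply: (@le_lt_trans _ _
  (\sum_(i <oo) ((2 * (2 * N + 1)) / (2 ^ (i + 1))%:R)%:E)%E).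
  apply: lee_nneseries => i _; first by [].
  apply: (le_trans (muA i)); rewrite lee_fin natrX addn1 exprS invfM mulrACA.
  by rewrite divff// mul1r.
have /cvg_lim := @cvg_geometric_eseries_half R (2 * (2 * N + 1)) 0.
by move=> ->//; rewrite ltry.
Qed.

(** Both terms of the bound [Phi_le] have summable integrals: [sum_muA] for the
first one; for the second one the translation by [d i] is undone under each
integral before the sum is taken back inside, where [h_sum] applies. *)
Let sum_Phi_lty : (\int[mu]_x (\sum_(i <oo) Phi i x) < +oo)%E.
Proof.
have mhs i := mshift (d i) (mh i).
rewrite integral_nneseries//.
apply: (@le_lt_trans _ _ (\sum_(i <oo) (mu (A i) + \int[mu]_x h i x))%E).
  apply: lee_nneseries => i _; first by move=> _; exact: integral_ge0.
  rewrite -(ge0_integral_shift (d i) (mh i))//.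
  have <- : (\int[mu]_x (\1_(A i) x)%:E = mu (A i))%E.
    by rewrite integral_indic ?setIT//; exact: mA.
  rewrite -ge0_integralD//; last 2 first.
  - by apply/measurable_EFinP/measurable_indic; exact: mA.
  - exact: mhs.
  apply: ge0_le_integral => //; first exact: mPhi.
  apply: emeasurable_funD; last exact: mhs.
  by apply/measurable_EFinP/measurable_indic; exact: mA.
rewrite nneseriesD//; last by move=> i _ _; exact: integral_ge0.
apply: lte_add_pinfty => //.
rewrite -integral_nneseries//.
apply: (@le_lt_trans _ _ (\int[mu]_x ((cst (1 + 2 * M)%:E \_ J') x))%E).
  apply: ge0_le_integral => //.
  - by move=> x _; exact: nneseries_ge0.
  - exact: (@ge0_emeasurable_sum _ _ _ setT h xpredT).
  - have mJ' : measurable J' by exact: measurable_itv.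
    by apply/(measurable_restrictT _ mJ').
rewrite -integral_mkcond integral_cst; last exact: measurable_itv.
by rewrite [X in (_ * X)%E](_ : _ = (2 * N + 1)%:E)// -EFinM ltry.
Qed.

Lemma backward_window : \forall x \ae mu, J x -> (s x <= M%:E)%E ->
  (\sum_(i <oo) G i (x + d i)%R < +oo)%E.
Proof.
have : mu.-integrable [set: R] (fun x => \sum_(i <oo) Phi i x)%E.
  apply/integrableP; split.
    exact: (@ge0_emeasurable_sum _ _ _ setT Phi xpredT).
  under eq_integral do rewrite gee0_abs ?nneseries_ge0//.
  exact: sum_Phi_lty.
move=> /integrable_ae-/(_ measurableT).
apply: filterS => x /(_ Logic.I) fin Jx sM.
apply: nneseries_mine1_lty => [i|i|]; first exact: G_ge0.
  exact: translate_sum_finite.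
move: fin; rewrite ge0_fin_numE ?nneseries_ge0//.
by congr (_ < _)%E; apply: eq_eseriesr => i _; rewrite /Phi patchE mem_set.
Qed.

End window.

(** The sets where [s x <= n] and [`|x| <= n] exhaust the convergence set. *)
Lemma backward_ae : \forall x \ae mu, (s x < +oo)%E ->
  (translate_sum f (\bigcup_i (fun z => (z + d i)%R) @` V i) x < +oo)%E.
Proof.
have h n := @backward_window n%:R n%:R (ler0n _ _) (ler0n _ _).
apply: filterS (ae_foralln h) => x {}h sx.
apply: (le_lt_trans (translate_sum_bigcup_le f0 _ _)).
rewrite (eq_eseriesr (g := fun i => G i (x + d i)%R)); last first.
  by move=> i _; exact: translate_sum_image.
have sxfin : s x \is a fin_num by rewrite ge0_fin_numE.
pose n := Num.Def.truncn (Num.max `|x| (fine (s x))).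
have nE : Num.max `|x| (fine (s x)) <= n.+1%:R.
  by rewrite ltW// truncnS_gt.
move: nE; rewrite ge_max => /andP[xn sn].
apply: (h n.+1).
  by rewrite /= in_itv/= -ler_norml.
by rewrite -(fineK sxfin) lee_fin.
Qed.

End backward.

(** * Reduction of type 1 to combinatorics of the set *)

Section borel_zero_one.
Context {R : realType}.
Local Notation mu :=
  (@lebesgue_measure R : {measure set (measurableTypeR R) -> \bar R}).
Variables (L F : set R) (V : nat -> set R) (d d' : nat -> R) (f : R -> R).
Hypotheses (cL : countable L) (VL : forall i, V i `<=` L)
  (tV : trivIset [set: nat] V) (finV : forall i, finite_set (V i))
  (d_ge0 : forall i, 0 <= d i) (d_le : forall i, d i * 2 ^+ i <= 1)
  (d'_ge0 : forall i, 0 <= d' i) (d'_le : forall i, d' i * 2 ^+ i <= 1)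
  (LV : forall i l z, (i < l)%N -> V l z ->
    L (z + d i) \/ forall c, (c < 2 ^ i)%N -> L (z - c%:R * d i))
  (LV' : forall i l z, (i < l)%N -> V l z ->
    L (z + d' i) \/ forall c, (c < 2 ^ i)%N -> L (z - c%:R * d' i))
  (L_fwd : forall m, exists2 E, finite_set E &
     forall l, L l -> (L `|` E) (l + (2 ^+ m)^-1))
  (finF : finite_set F)
  (L_bwd : forall l, L l -> (L `|` F `|` (\bigcup_i (fun z => z + d i) @` V i)
     `|` (\bigcup_i (fun z => z + d' i) @` V i)) (l - 1))
  (mf : measurable_fun [set: R] f) (f0 : forall x, 0 <= f x).

Let s x := translate_sum f L x.
Let C := convergence_set f L.

Lemma measurable_convergence_set : measurable C.
Proof.
rewrite -[X in measurable X]setTI; apply: emeasurable_fun_infty_o => //.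
exact: measurable_translate_sum.
Qed.

Lemma convergence_set_fwd m x : C x -> C (x + (2 ^+ m)^-1).
Proof.
rewrite /C /convergence_set /= => sx; have [E finE LE] := L_fwd m.
rewrite -translate_sum_image.
apply: (@le_lt_trans _ _ (s x + translate_sum f E x)%E).
  apply: le_trans (translate_sumU f0 _ _ _); apply: translate_sum_subset.
  by move=> _ [l Ll <-]; exact: LE.
by apply: lte_add_pinfty => //; exact: translate_sum_finite.
Qed.

(** The new points of [L - 1] are covered by the two families of shifted windows
that [backward_ae] controls, and by a finite set. *)
Lemma convergence_set_bwd : \forall x \ae mu, C x -> C (x - 1).
Proof.
have h := backward_ae cL VL tV finV d_ge0 d_le LV mf f0.
have h' := backward_ae cL VL tV finV d'_ge0 d'_le LV' mf f0.
have Fae := ae_filter_ringOfSetsType mu.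
apply: (filterS _ (filterI h h')) => x [{}h {}h'] Cx.
move: h h' => /(_ Cx) h /(_ Cx) h'.
rewrite /C /convergence_set /= -translate_sum_image.
apply: (@le_lt_trans _ _ (s x + translate_sum f F x +
  translate_sum f (\bigcup_i [set z + d i | z in V i]%R) x +
  translate_sum f (\bigcup_i [set z + d' i | z in V i]%R) x)%E); last first.
  by do 3 (apply: lte_add_pinfty => //); exact: translate_sum_finite.
apply: (@le_trans _ _ (translate_sum f _ x)).
  by apply: translate_sum_subset => _ [l Ll <-]; exact: (L_bwd Ll).
do 3 (apply: (le_trans (translate_sumU f0 _ _ _)); apply: leeD => //).
Qed.

Lemma borel_zero_one : mu C = 0%E \/ mu (~` C) = 0%E.
Proof.
apply: dyadic_zero_one; first exact: measurable_convergence_set.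
  by move=> m x; exact: convergence_set_fwd.
have mCm : measurable [set x | C (x - 1)].
  exact: (measurable_preimage_shift (-1) measurable_convergence_set).
apply/negligibleP.
  by apply: measurableD => //; exact: measurable_convergence_set.
apply: negligibleS convergence_set_bwd => x [Cx nCx] /=.
by move=> /(_ Cx).
Qed.

End borel_zero_one.

Section lebesgue_borel.
Context {R : realType}.
Local Notation mu :=
  (@lebesgue_measure R : {measure set (measurableTypeR R) -> \bar R}).

Lemma lebesgue_measurable_set_borel (A : set R) :
  measurable (A : set (lebesgueTypeR R)) ->
  exists B N : set R, [/\ measurable B, measurable N, mu N = 0%E,
    B `<=` A & A `<=` B `|` N].
Proof.
move=> mA.
have : (completed_algebra_gen mu) A.
  by rewrite -g_sigma_completed_algebra_genE completed_caratheodory_measurable.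
move=> [B mB [N' [N [mN N0 N'N]]] <-]; exists B, N; split => //.
exact: setUS.
Qed.

(** Each set [q < f] with [q] rational is Borel up to a null set; replacing [f]
by 0 on the union of these null sets makes all of them Borel at once. *)
Lemma lebesgue_measurable_fun_borel (f : R -> R) : lebesgue_measurable_fun f ->
  exists (g : R -> R) (N : set R), [/\ measurable_fun [set: R] g, measurable N,
    mu N = 0%E, (forall x, ~ N x -> f x = g x) & (forall x, N x -> g x = 0)].
Proof.
move=> mf.
have mfq (q : rat) :
    measurable ([set x | ratr q < f x] : set (lebesgueTypeR R)).
  rewrite (_ : [set x | _] =
      setT `&` (f : lebesgueTypeR R -> R) @^-1` `]ratr q, +oo[).
    by apply: mf => //; exact: measurable_itv.
  by apply/seteqP; split => x /=; rewrite in_itv/= andbT//; case.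
have /choice [B /choice [N hBN]] :=
  fun q => lebesgue_measurable_set_borel (mfq q).
pose N0 := \bigcup_(q : rat) N q.
have mN0 : measurable N0.
  by apply: countable_bigcupT_measurable => // q; have [] := hBN q.
have mu0 : mu N0 = 0%E.
  pose N' n := if unpickle n is Some q then N q else set0.
  have N'0 : mu.-negligible (\bigcup_n N' n).
    apply: negligible_bigcup => n; rewrite /N'.
    case: unpickle => [q|]; last exact: negligible_set0.
    by have [_ mN muN _ _] := hBN q; exists (N q); split.
  have N'N : N0 `<=` \bigcup_n N' n.
    move=> x [q _ Nqx]; exists (pickle q); first exact: Logic.I.
    rewrite /N' pickleK; exact: Nqx.
  have [A [mA A0 N'A]] := N'0.
  apply/eqP; rewrite eq_le measure_ge0 andbT.
  apply: (@le_trans _ _ (mu A)); last by rewrite A0.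
  apply: le_measure; rewrite ?inE//; exact: subset_trans N'A.
exists (fun x => if x \in N0 then 0 else f x), N0; split => //.
- move=> _; apply: (measurability _ (RGenOInfty.measurableE R)) => //.
  move=> _ [_ [a ->] <-]; rewrite setTI.
  rewrite (_ : _ @^-1` _ = \bigcup_(q in [set q : rat | a <= ratr q])
     ((B q `\` N0) `|` (if ratr q < (0 : R) then N0 else set0))).
    rewrite bigcup_mkcond; apply: bigcupT_measurable_rat => q.
    case: ifP => // _; have [mB _ _ _ _] := hBN q.
    apply: measurableU; first exact: measurableD.
    by case: ifP.
  apply/seteqP; split => [x /=|x [q /= aq]].
    rewrite in_itv/= andbT; have [N0x|N0x] := boolP (x \in N0) => ax.
      have [q] := rat_in_itvoo ax; rewrite in_itv/= => /andP[aq q0].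
      by exists q; [exact: ltW|right; rewrite q0; exact: set_mem].
    have [q] := rat_in_itvoo ax; rewrite in_itv/= => /andP[aq qf].
    exists q; first exact: ltW.
    left; have [_ _ _ _ sub] := hBN q.
    have nN0 : ~ N0 x by rewrite notin_setE in N0x.
    by split => //; case: (sub x qf) => // Nqx; exfalso; apply: nN0; exists q.
  rewrite in_itv/= andbT => -[[Bx nN0]|].
    rewrite ifN ?notin_setE//; have [_ _ _ sub _] := hBN q.
    exact: le_lt_trans aq (sub x Bx).
  by case: ifP => // q0 N0x; rewrite mem_set//; exact: le_lt_trans aq q0.
- by move=> x Nx; rewrite ifN// notin_setE.
- by move=> x Nx; rewrite mem_set.
Qed.

Lemma translate_sum_ae_eq (L : set R) (f g : R -> R) (N : set R) :
  countable L -> measurable N -> mu N = 0%E -> (forall x, ~ N x -> f x = g x) ->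
  mu.-negligible [set x | translate_sum f L x != translate_sum g L x].
Proof.
move=> /countable_injP[e einj] mN N0 fg.
pose N' n : set R := [set x | exists l, [/\ L l, e l = n & N (x + l)]].
have N'0 : mu.-negligible (\bigcup_n N' n).
  apply: negligible_bigcup => n.
  have [[l [Ll eln]]|nl] := pselect (exists l, L l /\ e l = n); last first.
    exists set0; split => // x [l [Ll eln _]].
    by apply: nl; exists l.
  exists ((fun x : R => x + l) @^-1` N); split.
  - exact: measurable_preimage_shift.
  - exact: etrans (lebesgue_measure_shift l mN) N0.
  - move=> x [l' [Ll' el'n Nxl']] /=.
    by rewrite (einj l l') ?inE// eln.
have [A [mA A0 N'A]] := N'0; exists A; split => //.
apply: subset_trans N'A => x /= /negP neq.
apply: contrapT => nN'; apply: neq; apply/eqP/eq_esum => l Ll.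
congr (_%:E); apply: fg => Nxl; apply: nN'.
by exists (e l) => //; exists l.
Qed.

End lebesgue_borel.

Lemma type1_of_borel {R : realType} (L : set R) : countable L ->
  (forall g : R -> R, measurable_fun [set: R] g -> (forall x, 0 <= g x) ->
    lebesgue_measure (convergence_set g L) = 0%E \/
    lebesgue_measure (~` convergence_set g L) = 0%E) ->
  type1 L.
Proof.
move=> cL zo f mf f0.
have [g [N [mg mN N0 fg gN]]] := lebesgue_measurable_fun_borel mf.
have g0 x : 0 <= g x.
  by have [/gN ->//|/fg <-] := pselect (N x).
have [E [mE E0 neqE]] := translate_sum_ae_eq cL mN N0 fg.
have null (A B : set R) : measurable B -> lebesgue_measure B = 0%E ->
    A `<=` B `|` [set x | translate_sum f L x != translate_sum g L x] ->
    completed_lebesgue_measure A = 0%E.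
  move=> mB B0 AB; apply/negligible_outer_measure.
  exists (B `|` E); split.
  - exact: measurableU.
  - by rewrite measureU0.
  - by apply: (subset_trans AB); exact: setUS.
have mC := measurable_convergence_set cL mg g0.
have [C0|C0] := zo g mg g0; [right|left].
  apply: null mC C0 _ => x /= Cx.
  have [fgx|fgx] := eqVneq (translate_sum f L x) (translate_sum g L x).
    by left; rewrite /convergence_set /= -fgx.
  by right.
apply: null (measurableC mC) C0 _ => x /= Dx.
have [fgx|fgx] := eqVneq (translate_sum f L x) (translate_sum g L x).
  by left; rewrite /convergence_set /= -fgx Dx.
by right.
Qed.

(** * Transcendental numbers *)

Section transcendental.
Context {R : realType}.

Lemma finite_roots (p : {poly R}) : p != 0 -> finite_set [set x | root p x].
Proof.
move=> p0; apply: contrapT => /(infinite_set_fset (size p))[B Bp sB].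
have aB : all (root p) (finmap.enum_fset B) by apply/allP => x xB; exact: Bp.
have := max_poly_roots p0 aB (finmap.fset_uniq B).
by rewrite ltnNge sB.
Qed.

(** Algebraic numbers are countably many, hence do not cover an interval. *)
Lemma exists_transcendental (b : R) : 0 < b ->
  exists2 t : R, 0 < t < b &
    forall p : {poly int}, (map_poly intr p : {poly R}).[t] = 0 -> p = 0.
Proof.
move=> b0; apply: contrapT => nt.
pose A : set R := \bigcup_(p in [set p : {poly int} | p != 0])
  [set x | root (map_poly intr p) x].
have cA : countable A.
  apply: bigcup_countable => [|p /= p0]; first exact: countableP.
  apply: finite_set_countable; apply: finite_roots.
  by rewrite map_poly_eq0_id0// intr_eq0 lead_coef_eq0.
pose I : set R := `]0, b[%classic.
have : (lebesgue_measure I <= lebesgue_measure A)%E.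
  apply: le_measure; rewrite ?inE; first exact: measurable_itv.
    exact: countable_measurable.
  move=> x; rewrite /I /= in_itv/= => xb; apply: contrapT => nAx; apply: nt.
  exists x => // p px; apply/eqP/negPn/negP => p0; apply: nAx; exists p => //.
  exact/rootP.
rewrite /I lebesgue_measure_itv/= lte_fin b0 -EFinB subr0.
by rewrite countable_lebesgue_measure0// lee_fin leNgt b0.
Qed.

End transcendental.

Lemma infinite_range {T : Type} (f : nat -> T) :
  injective f -> infinite_set (range f).
Proof.
move=> finj.
have /inj_card_eq/eq_finite_set -> : {in [set: nat] &, injective f}.
  by move=> x y _ _; exact: finj.
exact: infinite_nat.
Qed.

(** * The set and its layers *)

Section lattice.
Context {R : realType}.
Variable t : R.
Hypotheses (t_gt0 : 0 < t) (t_lt : t < 2^-1).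

(** Indices start at 0: [generator k] is the shift [g_(k + 1)] of the
introduction.  For [k.+1] in [[2 ^ i, 2 ^ i.+1[] one dyadic shift is followed
by [2 ^ i - 1] copies of [t ^+ i]. *)
Definition generator (k : nat) : R :=
  let i := trunc_log 2 k.+1 in
  if k.+1 == (2 ^ i)%N then (2 ^+ i)^-1 else t ^+ i.

Definition subset_sum (n : nat) (a : int) (e : nat -> bool) : R :=
  a%:~R + \sum_(k < n) (e k)%:R * generator k.

Definition layer (n : nat) : set R :=
  [set z | exists a e, z = subset_sum n a e].

Definition lambda_set : set R :=
  [set z | exists n, layer n z /\ n%:R * 4 <= z < n%:R * 4 + 4].

(** Points just below the end [4 * k.+1] of a block, where the layer is about to
be enlarged by [generator k]; stage [i] collects the [k] with
[2 ^ i <= k.+1 < 2 ^ i.+1]. *)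
Definition window (i : nat) : set R :=
  [set z | exists k, [/\ trunc_log 2 k.+1 = i, layer k z &
    k%:R * 4 + 2 <= z < k%:R * 4 + 4]].

Let t_ge0 : 0 <= t. Proof. exact: ltW. Qed.

Let t_pow_le i : t ^+ i * 2 ^+ i <= 1.
Proof.
rewrite -exprMn exprn_ile1//; first by rewrite mulr_ge0.
by have := t_lt; lra.
Qed.

Let generator_gt0 k : 0 < generator k.
Proof.
by rewrite /generator; case: ifP => _; rewrite ?invr_gt0 exprn_gt0.
Qed.

Let generator_le1 k : generator k <= 1.
Proof.
rewrite /generator; case: ifP => _.
  by rewrite invf_le1 ?exprn_gt0// exprn_ege1// ler1n.
by apply: exprn_ile1 => //; have := t_lt; lra.
Qed.

Lemma generator_pow2 i : generator (2 ^ i).-1 = (2 ^+ i)^-1.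
Proof.
by rewrite /generator prednK ?expn_gt0// trunc_expnK// eqxx.
Qed.

Lemma generator_power i k : (2 ^ i <= k < (2 ^ i.+1).-1)%N ->
  generator k = t ^+ i.
Proof.
move=> /andP[ik ki].
have ki' : (k.+1 < 2 ^ i.+1)%N by rewrite -ltn_predRL.
rewrite /generator (@trunc_log_eq 2 i k.+1)//; last first.
  by rewrite (leq_trans ik)//= -ltn_predRL.
by rewrite gtn_eqF.
Qed.

Lemma subset_sum_add n a (e : nat -> bool) k : (k < n)%N -> ~~ e k ->
  subset_sum n a e + generator k =
  subset_sum n a (fun j => (j == k) || e j).
Proof.
move=> kn ek; rewrite /subset_sum -addrA; congr (_ + _).
rewrite (bigD1 (Ordinal kn))//= [in RHS](bigD1 (Ordinal kn))//= eqxx.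
rewrite (negbTE ek) mul0r add0r mul1r addrC; congr (_ + _).
apply: eq_bigr => j jk.
by rewrite (_ : (_ == k) = false)//; apply/negbTE; apply: contra jk.
Qed.

Lemma subset_sum_sub n a (e : nat -> bool) k : (k < n)%N -> e k ->
  subset_sum n a e - generator k =
  subset_sum n a (fun j => (j != k) && e j).
Proof.
move=> kn ek.
rewrite -[LHS]addr0 -[RHS]addr0; apply/eqP; rewrite !addr0 subr_eq; apply/eqP.
rewrite subset_sum_add//= ?eqxx//.
rewrite /subset_sum; congr (_ + _); apply: eq_bigr => j _.
by case: eqP => // ->; rewrite ek.
Qed.

Lemma layer_succ n : layer n `<=` layer n.+1.
Proof.
move=> _ [a [e ->]]; exists a, (fun k => (k < n)%N && e k).
rewrite /subset_sum big_ord_recr/= ltnn mul0r addr0; congr (_ + _).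
by apply: eq_bigr => k _; rewrite ltn_ord.
Qed.

Lemma layer_le m n : (m <= n)%N -> layer m `<=` layer n.
Proof.
move=> /subnK <-; elim: (n - m)%N => // k IH.
by apply: (subset_trans IH); exact: layer_succ.
Qed.

Lemma layer_succE n z : layer n.+1 z -> layer n z \/ layer n (z - generator n).
Proof.
move=> [a [e ->]]; rewrite /subset_sum big_ord_recr/=.
case: (e n) => /=; [right|left]; exists a, e.
  by rewrite mul1r addrA addrK.
by rewrite mul0r addr0.
Qed.

Lemma layerDint n z (k : int) : layer n z -> layer n (z + k%:~R).
Proof.
move=> [a [e ->]]; exists (a + k), e; rewrite /subset_sum intrD; ring.
Qed.

(** Binary carry: if [2^-(m+1)] is already used in the sum, remove it and add
[2^-m] instead. *)
Lemma layerD_dyadic n m z : (2 ^ m <= n)%N -> layer n z ->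
  layer n (z + (2 ^+ m)^-1).
Proof.
elim: m z => [|m IH] z mn; first by rewrite expr0 invr1; exact: (layerDint 1).
move=> [a [e zE]]; pose k := (2 ^ m.+1).-1.
have kn : (k < n)%N by rewrite /k prednK// expn_gt0.
have Dk : generator k = (2 ^+ m.+1)^-1 by exact: generator_pow2.
have [ek|ek] := boolP (e k); last first.
  by exists a, (fun j => (j == k) || e j); rewrite zE -Dk subset_sum_add.
have -> : z + (2 ^+ m.+1)^-1 = z - generator k + (2 ^+ m)^-1.
  rewrite Dk exprS; field; exact: expf_neq0.
apply: IH; first by apply: leq_trans mn; rewrite leq_exp2l.
by exists a, (fun j => (j != k) && e j); rewrite zE subset_sum_sub.
Qed.

(** Either some copy of [t ^+ i] is not yet used and can be added, or all
[2 ^ i - 1] copies are used and any number of them can be removed. *)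
Lemma layerD_power n i z : (2 ^ i.+1 <= n.+1)%N -> layer n z ->
  layer n (z + t ^+ i) \/
  forall c, (c < 2 ^ i)%N -> layer n (z - c%:R * t ^+ i).
Proof.
move=> ni [a [e zE]].
have i2 : (2 ^ i.+1 = 2 ^ i + 2 ^ i)%N by rewrite expnS mul2n addnn.
have [[k [ik ki ek]]|full] := pselect (exists k,
    [/\ (2 ^ i <= k)%N, (k < (2 ^ i.+1).-1)%N & ~~ e k]).
  left; exists a, (fun j => (j == k) || e j).
  rewrite zE -(@generator_power i k) ?ik// subset_sum_add//.
  by apply: leq_trans ki _; rewrite -ltnS prednK ?expn_gt0.
(* The indices of the copies of [t ^+ i] start at [2 ^ i]: drop [c] of them. *)
right => c ci; exists a, (fun k => ~~ (2 ^ i <= k < 2 ^ i + c)%N && e k).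
rewrite zE; elim: c ci => [|c IH] ci.
  rewrite mul0r subr0 /subset_sum; congr (_ + _); apply: eq_bigr => k _.
  by rewrite addn0; case: ltnP => // h; rewrite leqNgt h.
have ck : (2 ^ i <= 2 ^ i + c < (2 ^ i.+1).-1)%N.
  by rewrite leq_addr/= ltn_predRL i2 -addnS ltn_add2l.
have kn : (2 ^ i + c < n)%N.
  have /andP[_ h] := ck; apply: leq_trans h _.
  by rewrite -ltnS prednK ?expn_gt0.
rewrite -[c.+1%:R]natr1 mulrDl mul1r opprD addrA IH; last exact: ltnW.
rewrite -(generator_power ck) subset_sum_sub//; last first.
  rewrite ltnn andbF/=; apply: contrapT => /negP ne.
  by apply: full; exists (2 ^ i + c)%N; have /andP[h1 h2] := ck.
rewrite /subset_sum; congr (_ + _); apply: eq_bigr => k _; congr (_%:R * _).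
congr nat_of_bool; rewrite andbA -negb_or addnS ltnS [(k <= _)%N]leq_eqVlt.
congr (~~ _ && _); case: eqVneq => //= ->.
by rewrite leq_addr.
Qed.

Lemma lambda_block n z : layer n z -> n%:R * 4 <= z < n%:R * 4 + 8 ->
  lambda_set z.
Proof.
move=> nz /andP[z1 z2]; have [h|h] := ltP z (n%:R * 4 + 4).
  by exists n; rewrite z1 h.
exists n.+1; split; first exact: layer_succ.
by rewrite -[n.+1%:R]natr1; apply/andP; split; lra.
Qed.

(** The finite part of a sum is bounded by [S], so the integer part is bounded
too, and there are finitely many choices for both. *)
Lemma finite_layer n (b : R) : finite_set [set z | layer n z /\ `|z| <= b].
Proof.
pose S := \sum_(k < n) generator k; pose B := Num.Def.truncn (b + S).
pose G (u : nat * {ffun 'I_n -> bool}) : R :=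
  u.1%:R - B.+1%:R + \sum_(k < n) (u.2 k)%:R * generator k.
apply: (@sub_finite_set _ _ (G @` (`I_(2 * B.+1).+1 `*` setT))); last first.
  apply/finite_image/finite_setX; [exact: finite_II|exact: finite_finset].
move=> z [[a [e zE]] zb].
pose s := \sum_(k < n) (e k)%:R * generator k.
have s0 : 0 <= s.
  by apply: sumr_ge0 => k _; rewrite mulr_ge0// ltW// generator_gt0.
have sS : s <= S.
  apply: ler_sum => k _; rewrite ler_piMl ?(ltW (generator_gt0 _))//.
  by case: (e k); rewrite ?ler01.
have zE' : z = a%:~R + s by [].
have : `|a%:~R| <= b + S.
  have -> : a%:~R = z - s by rewrite zE' addrK.
  by rewrite (le_trans (ler_normB _ _))// (ger0_norm s0) lerD.
have B1 : b + S < B.+1%:R by exact: truncnS_gt.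
move=> /le_lt_trans-/(_ _ B1); rewrite ltr_norml => /andP[a1 a2].
have a1' : - (B.+1%:Z) < a by rewrite -(ltr_int R) rmorphN.
have a2' : a < B.+1%:Z by rewrite -(ltr_int R).
exists (absz (a + B.+1%:Z)%R, [ffun k : 'I_n => e k]) => /=.
  by split => //=; lia.
rewrite /G /= zE'; congr (_ + _).
  rewrite -[_%:R in LHS]/((Posz _)%:~R) gez0_abs; last by lia.
  by rewrite intrD addrK.
by apply: eq_bigr => k _; rewrite ffunE.
Qed.

Lemma lambda_ge0 z : lambda_set z -> 0 <= z.
Proof.
by move=> [n [_ /andP[h _]]]; apply: le_trans h; rewrite mulr_ge0.
Qed.

Lemma finite_lambda (b : R) : finite_set (lambda_set `&` [set z | z <= b]).
Proof.
pose N := Num.Def.truncn b.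
apply: (@sub_finite_set _ _ [set z | layer N.+1 z /\ `|z| <= b]); last first.
  exact: finite_layer.
move=> z [zL /= zb]; split; last by rewrite ger0_norm// lambda_ge0.
have [n [nz /andP[z1 _]]] := zL; apply: layer_le nz.
have bN : b < N.+1%:R by exact: truncnS_gt.
rewrite -(ler_nat R); have : 0 <= n%:R :> R by [].
by have := zb; lra.
Qed.

Lemma countable_lambda : countable lambda_set.
Proof.
rewrite (_ : lambda_set = \bigcup_n (lambda_set `&` [set z | z <= n%:R])).
  apply: bigcup_countable => [|n _]; first exact: countableP.
  by apply: finite_set_countable; exact: finite_lambda.
apply/seteqP; split => [z Lz|z [n _ []//]].
exists (Num.Def.truncn z).+1 => //; split => //=.
by rewrite ltW// truncnS_gt.
Qed.

Lemma lambda_nat n : lambda_set (n%:R * 4).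
Proof.
exists n; split; last first.
  by apply/andP; split; lra.
exists (n * 4)%:Z, (fun=> false); rewrite /subset_sum big1 ?addr0 => [|k _].
  by rewrite -[_%:~R]/((n * 4)%:R) natrM.
by rewrite mul0r.
Qed.

Lemma admissible_lambda : admissible lambda_set.
Proof.
have unb : ~ bounded_set lambda_set.
  move=> [M [_ /(_ (Num.max 1 (M + 1)))]].
  rewrite lt_max ltrDl ltr01 orbT => /(_ isT) h.
  set m := Num.max 1 (M + 1) in h.
  have m1 : 1 <= m by rewrite le_max lexx.
  have := h _ (lambda_nat (Num.Def.truncn m).+1).
  have := truncnS_gt m; set k := (_.+1%:R) => km.
  by rewrite /= ger0_norm => [|]; lra.
split => //.
- exact: countable_lambda.
- apply: (@sub_infinite_set _ (range (fun n => n%:R * 4 : R))).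
    by move=> _ [n _ <-]; exact: lambda_nat.
  apply: infinite_range => m n /(mulIf _)/eqP.
  by rewrite eqr_nat pnatr_eq0 => /(_ isT)/eqP.
- by exists 0 => z; exact: lambda_ge0.
- apply/seteqP; split => // z /limit_point_infinite_setP.
  have nz : nbhs z `]z - 1, z + 1[%classic.
    by apply: near_in_itvoo; rewrite in_itv/=; apply/andP; split; lra.
  move=> /(_ _ nz); apply.
  apply: sub_finite_set (finite_lambda (z + 1)) => y [/=].
  by rewrite in_itv/= => /andP[_ /ltW].
Qed.

Lemma window_sub i : window i `<=` lambda_set.
Proof.
move=> z [k [_ kz /andP[z1 z2]]]; exists k; split => //.
by apply/andP; split; lra.
Qed.

Lemma window_trivIset : trivIset [set: nat] window.
Proof.
move=> i j _ _ [z [[k [<- _ /andP[k1 k2]]] [l [<- _ /andP[l1 l2]]]]].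
have kl m n : m%:R * 4 + 2 <= z -> z < n%:R * 4 + 4 -> (m <= n)%N.
  move=> h1 h2; rewrite -ltnS -(ltr_nat R) -[n.+1%:R]natr1; lra.
congr (trunc_log 2 _.+1); apply/eqP.
by rewrite eqn_leq !kl.
Qed.

Lemma finite_window i : finite_set (window i).
Proof.
apply: sub_finite_set (finite_lambda ((2 ^ i.+1)%:R * 4 + 4)) => z zw.
split; first exact: window_sub zw.
have [k [ki _ /andP[_ z2]]] := zw; rewrite /= (le_trans (ltW z2))// lerD2r.
rewrite ler_wpM2r// ler_nat ltnW//; apply: ltnW.
by rewrite -ki; exact: trunc_log_ltn.
Qed.

Let window_pow i k : trunc_log 2 k.+1 = i -> (2 ^ i <= k.+1)%N.
Proof. by move=> <-; exact: trunc_logP. Qed.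

Lemma window_dyadic i l z : (i < l)%N -> window l z ->
  lambda_set (z + (2 ^+ i)^-1).
Proof.
move=> il [k [/window_pow kl kz /andP[z1 z2]]].
apply: (@lambda_block k).
  apply: layerD_dyadic kz; rewrite -ltnS; apply: leq_trans kl.
  by rewrite ltn_exp2l.
have : 0 < (2 ^+ i : R)^-1 by rewrite invr_gt0 exprn_gt0.
have : (2 ^+ i : R)^-1 <= 1 by rewrite invf_le1 ?exprn_gt0// exprn_ege1// ler1n.
move=> h1 h2; apply/andP; split; lra.
Qed.

Lemma window_power i l z : (i < l)%N -> window l z ->
  lambda_set (z + t ^+ i) \/
  forall c, (c < 2 ^ i)%N -> lambda_set (z - c%:R * t ^+ i).
Proof.
move=> il [k [/window_pow kl kz /andP[z1 z2]]].
have ti0 : 0 < t ^+ i by rewrite exprn_gt0.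
have ti1 : t ^+ i <= 1 by apply: exprn_ile1 => //; have := t_lt; lra.
have ik : (2 ^ i.+1 <= k.+1)%N by apply: leq_trans kl; rewrite leq_exp2l.
have [h|h] := layerD_power ik kz; [left|right => c ci].
  by apply: (lambda_block h); apply/andP; split; lra.
apply: (lambda_block (h c ci)).
have : 0 <= c%:R * t ^+ i by rewrite mulr_ge0// ltW.
have : c%:R * t ^+ i <= 1.
  apply: le_trans (t_pow_le i); rewrite mulrC ler_wpM2l ?(ltW ti0)//.
  by rewrite -natrX ler_nat ltnW.
by move=> h1 h2; apply/andP; split; lra.
Qed.

Lemma lambda_forward m : exists2 E, finite_set E &
  forall l, lambda_set l -> (lambda_set `|` E) (l + (2 ^+ m)^-1).
Proof.
exists ((fun l => l + (2 ^+ m)^-1) @`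
    (lambda_set `&` [set z | z <= (2 ^ m)%:R * 4])).
  by apply: finite_image; exact: finite_lambda.
move=> l Ll; have [n [nl /andP[l1 l2]]] := Ll.
have [mn|nm] := leqP (2 ^ m) n; [left|right]; last first.
  exists l => //; split => //=; apply: (le_trans (ltW l2)).
  have : n.+1%:R <= (2 ^ m)%:R :> R by rewrite ler_nat.
  by rewrite -[n.+1%:R]natr1; lra.
apply: (@lambda_block n); first exact: layerD_dyadic.
have : 0 < (2 ^+ m : R)^-1 by rewrite invr_gt0 exprn_gt0.
have : (2 ^+ m : R)^-1 <= 1 by rewrite invf_le1 ?exprn_gt0// exprn_ege1// ler1n.
by move=> h1 h2; apply/andP; split; lra.
Qed.

(** A point of [L - 1] that leaves its block [n.+1] downwards lies in
[layer n.+1], which is [layer n] together with its translate by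
[generator n].  The exceptional point [-1] comes from the first block. *)
Lemma lambda_backward l : lambda_set l ->
  (lambda_set `|` [set -1] `|`
    (\bigcup_i (fun z => z + (2 ^+ i)^-1) @` window i) `|`
    (\bigcup_i (fun z => z + t ^+ i) @` window i)) (l - 1).
Proof.
move=> [n [nl /andP[l1 l2]]].
have nl' : layer n (l - 1) := layerDint (-1) nl.
have [h|h] := leP (n%:R * 4) (l - 1).
  by do 3 left; apply: (lambda_block nl'); apply/andP; split; lra.
case: n => [|n] in nl nl' l1 l2 h *.
  left; left; right; case: nl => a [e le].
  rewrite /subset_sum big_ord0 addr0 in le; rewrite mul0r in l1 l2 h.
  have a0 : -1 < a by rewrite -(ltr_int R) -le; rewrite rmorphN1; lra.
  have a1 : a < 1 by rewrite -(ltr_int R) -le; lra.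
  have -> : l = 0 by rewrite le (_ : a = 0)//; lia.
  by rewrite /= sub0r.
rewrite -[n.+1%:R]natr1 in l1 l2 h.
case: (layer_succE nl') => [nz|nz].
  by do 3 left; apply: (lambda_block nz); apply/andP; split; lra.
have nw : window (trunc_log 2 n.+1) (l - 1 - generator n).
  exists n; split => //.
  have := generator_gt0 n; have := generator_le1 n => h1 h2.
  by apply/andP; split; lra.
move: nw; set i := trunc_log 2 n.+1 => nw.
have : generator n = (2 ^+ i)^-1 \/ generator n = t ^+ i.
  by rewrite /generator -/i; case: ifP; [left|right].
case=> gE; [left; right|right]; exists i => //;
  by exists (l - 1 - generator n) => //; rewrite gE subrK.
Qed.

Lemma type1_lambda : type1 lambda_set.
Proof.
apply: type1_of_borel; first exact: countable_lambda.
move=> g mg g0.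
apply: (@borel_zero_one R lambda_set [set -1] window
  (fun i => (2 ^+ i)^-1) (fun i => t ^+ i)) => //.
- exact: countable_lambda.
- exact: window_sub.
- exact: window_trivIset.
- exact: finite_window.
- by move=> i; rewrite mulVf// expf_neq0.
- by move=> i; rewrite exprn_ge0.
- by move=> i l z il zw; left; exact: window_dyadic il zw.
- exact: window_power.
- exact: lambda_forward.
- exact: lambda_backward.
Qed.

(** The integer part places the point in the first block whose layer contains a
copy of [t ^+ j]. *)
Definition independent_point (j : nat) : R := (2 ^ j).+1%:R * 4 + t ^+ j.

Lemma lambda_independent_point j : (0 < j)%N ->
  lambda_set (independent_point j).
Proof.
move=> j0; pose n := (2 ^ j)%N.
have nj : (2 ^ j <= n < (2 ^ j.+1).-1)%N.
  have : (1 < n)%N by rewrite /n -(expn0 2) ltn_exp2l.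
  by rewrite leqnn ltn_predRL expnS -/n; lia.
exists n.+1; split.
  exists (n.+1 * 4)%:Z, (fun k => k == n).
  rewrite /subset_sum big_ord_recr/= eqxx mul1r (generator_power nj).
  rewrite big1 ?add0r => [|k _]; last first.
    by rewrite ltn_eqF ?mul0r.
  by rewrite /independent_point -[_%:~R]/((n.+1 * 4)%:R) natrM.
have : 0 < t ^+ j by rewrite exprn_gt0.
have : t ^+ j <= 1 by apply: exprn_ile1 => //; have := t_lt; lra.
by rewrite /independent_point -/n => h1 h2; apply/andP; split; lra.
Qed.

(** An integer relation is an integer polynomial vanishing at [t]; as the
exponents are positive and distinct, its coefficients of positive degree are
those of the relation. *)
Lemma independent_points :
  (forall p : {poly int}, (map_poly intr p : {poly R}).[t] = 0 -> p = 0) ->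
  exists A : set R,
    [/\ A `<=` lambda_set, infinite_set A & algebraically_independent A].
Proof.
move=> t_transc; exists (range (fun j => independent_point j.+1)).
have mono i j : (i < j)%N -> independent_point i < independent_point j.
  move=> ij; have : ((2 ^ i).+2)%:R <= (2 ^ j).+1%:R :> R.
    by rewrite ler_nat ltnS ltn_exp2l.
  have : t ^+ i <= 1 by apply: exprn_ile1 => //; have := t_lt; lra.
  have : 0 < t ^+ j by rewrite exprn_gt0.
  rewrite /independent_point -[(2 ^ i).+2%:R]natr1; lra.
have inj : injective independent_point.
  move=> i j ij; case: (ltngtP i j) => // /mono; by rewrite ij ltxx.
split.
- by move=> _ [j _ <-]; exact: lambda_independent_point.
- by apply: infinite_range => i j /inj[].
- move=> N a k ainj aA sum0 i.
  have /choice [j aE] : forall i, exists j,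
      (0 < j)%N /\ independent_point j = a i.
    by move=> i'; have [j' _ <-] := aA i'; exists j'.+1.
  have jinj : injective j.
    by move=> x y xy; apply: ainj; rewrite -(aE x).2 -(aE y).2 xy.
  pose p : {poly int} :=
    \sum_(i < N) k i *: (((2 ^ j i).+1 * 4)%:Z%:P + 'X^(j i)).
  have p0 : p = 0.
    apply: t_transc; rewrite rmorph_sum/= horner_sum -[RHS]sum0.
    apply: eq_bigr => i' _.
    rewrite map_polyZ/= rmorphD/= map_polyC/= map_polyXn.
    rewrite hornerZ hornerD hornerC hornerXn -(aE i').2.
    rewrite /independent_point.
    by rewrite -[_%:~R in X in _ * (X + _)]/(((2 ^ j i').+1 * 4)%:R) natrM.
  have := congr1 (fun q : {poly int} => q`_(j i)) p0.
  rewrite coef0 /p coef_sum (bigD1 i)//= big1 ?addr0 => [|i' i'i].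
    rewrite coefZ coefD coefC coefXn eqxx gtn_eqF ?add0r ?mulr1//.
    by have [] := aE i.
  rewrite coefZ coefD coefC coefXn gtn_eqF; last by have [] := aE i.
  rewrite add0r eq_sym (inj_eq jinj) (negbTE i'i).
  by rewrite mulr0.
Qed.

End lattice.

Theorem theorem3p4 (R : realType) :
  exists L : set R,
    [/\ admissible L, type1 L
      & exists A : set R,
          [/\ A `<=` L, infinite_set A & algebraically_independent A]].
Proof.
have half_gt0 : 0 < 2^-1 :> R by rewrite invr_gt0.
have [t /andP[t0 t2] t_transc] := exists_transcendental half_gt0.
exists (lambda_set t); split.
- exact: admissible_lambda.
- exact: type1_lambda.
- exact: independent_points.
Qed.
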